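(* Let $\gamma>0$. Suppose that $Y$ is a closed convex set and that, for every $x\in X$, the functions $f(x,\cdot)$ and $g_1(x,\cdot),\dots,g_l(x,\cdot)$ are convex on $Y$. Then the problem $$(\mathrm{VP})_\gamma:\quad \min_{(x,y)\in C} F(x,y)\quad\text{s.t.}\quad f(x,y)-v_\gamma(x,y)\le 0$$ is equivalent to the bilevel program $$(\mathrm{BP}):\quad \min_{x\in X,\,y\in Y}F(x,y)\quad\text{s.t.}\quad y\in S(x),$$ i.e. the two problems, which have the same objective function $F$, have the same feasible set.
   Context: Here $X\subseteq\mathbb{R}^n$, $Y\subseteq\mathbb{R}^m$, $F,f:X\times Y\to\mathbb{R}$ and $g=(g_1,\dots,g_l):X\times Y\to\mathbb{R}^l$; the inequality $g(x,y)\le 0$ is componentwise. For $x\in X$ put $\mathcal{F}(x)=\{y\in Y: g(x,y)\le 0\}$ and $S(x)=\operatorname{argmin}_{y\in Y}\{f(x,y)\ \text{s.t.}\ g(x,y)\le 0\}$. Standing assumption: $S(x)\neq\emptyset$ for every $x\in X$. Put $C=\{(x,y)\in X\times Y: y\in\mathcal{F}(x)\}$. For $\gamma>0$ the Moreau envelope function is $$v_\gamma(x,y)=\inf_{w\in\mathcal{F}(x)}\Big\{f(x,w)+\frac{1}{2\gamma}\|w-y\|^2\Big\},\qquad (x,y)\in X\times\mathbb{R}^m .$$ *)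

(* Defs.v *)
From mathcomp Require Import all_boot all_order all_algebra.
From mathcomp Require Import all_classical all_reals all_analysis.
Set Implicit Arguments.
Unset Strict Implicit.
Unset Printing Implicit Defensive.
Import Order.TTheory GRing.Theory Num.Theory.
Import numFieldNormedType.Exports.

Local Open Scope classical_set_scope.
Local Open Scope ring_scope.

(* The canonical norm `|v| on 'rV[R]_m is the sup norm; the proximal term of
   the Moreau envelope needs the Euclidean one. *)
Definition l2norm (R : realType) (m : nat) (v : 'rV[R]_m) : R :=
  Num.sqrt (\sum_(j < m) v ord0 j ^+ 2).

Record min_problem (R : realType) (T : Type) := MinProblem {
  objective : T -> R ;
  feasible : set T
}.

Definition equivalent_problems (R : realType) (T : Type)
    (P Q : min_problem R T) : Prop :=
  objective P = objective Q /\ feasible P = feasible Q.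

(* The data F, f, g of the bilevel program are given as total functions on
   'rV_n and 'rV_m; only their values on X `*` Y are used below. *)
Section Bilevel.
Variables (R : realType) (n m l : nat).
Variables (X : set 'rV[R]_n) (Y : set 'rV[R]_m).
Variables (F f : 'rV[R]_n -> 'rV[R]_m -> R).
Variable g : 'rV[R]_n -> 'rV[R]_m -> 'rV[R]_l.

Definition lower_feasible (x : 'rV[R]_n) : set 'rV[R]_m :=
  [set y | Y y /\ forall i : 'I_l, g x y ord0 i <= 0].

Definition lower_argmin (x : 'rV[R]_n) : set 'rV[R]_m :=
  [set y | lower_feasible x y /\
    forall w, lower_feasible x w -> f x y <= f x w].

Definition joint_feasible : set ('rV[R]_n * 'rV[R]_m) :=
  [set z | (X `*` Y) z /\ lower_feasible z.1 z.2].

(* Taken in \bar R, so that the infimum is the true one without any assumption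
   of boundedness from below or of nonemptiness. *)
Definition moreau_envelope (gamma : R) (x : 'rV[R]_n) (y : 'rV[R]_m) : \bar R :=
  ereal_inf [set (f x w + (2 * gamma)^-1 * l2norm (w - y) ^+ 2)%:E
            | w in lower_feasible x].

Definition bilevel_problem : min_problem R ('rV[R]_n * 'rV[R]_m) :=
  MinProblem (fun z => F z.1 z.2)
    [set z | (X `*` Y) z /\ lower_argmin z.1 z.2].

Definition moreau_problem (gamma : R) : min_problem R ('rV[R]_n * 'rV[R]_m) :=
  MinProblem (fun z => F z.1 z.2)
    [set z | joint_feasible z /\
      ((f z.1 z.2)%:E - moreau_envelope gamma z.1 z.2 <= 0)%E].

End Bilevel.

(* Main.v *)
Require Import Defs.
From mathcomp Require Import all_boot all_order all_algebra.
From mathcomp Require Import all_classical all_reals all_analysis.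
From mathcomp Require Import lra.
Import Order.TTheory GRing.Theory Num.Theory.
Import numFieldNormedType.Exports.
Local Open Scope classical_set_scope.
Local Open Scope ring_scope.

(** The constraint says that [y] minimizes the prox-regularized objective
    [f x w + |w - y|^2 / (2 gamma)] over the convex set of feasible [w]. On
    the segment from [y] to a feasible [w], convexity makes the gain in [f x]
    linear in the step [t] while the proximal penalty is only quadratic in [t],
    so letting [t] tend to [0] shows that [y] minimizes [f x] itself. *)

Lemma l2normZ_sqr (R : realType) (m : nat) (a : R) (v : 'rV[R]_m) :
  l2norm (a *: v) ^+ 2 = a ^+ 2 * l2norm v ^+ 2.
Proof.
rewrite /l2norm !sqr_sqrtr ?sumr_ge0// => [|j _|j _]; rewrite ?sqr_ge0//.
by rewrite mulr_sumr; apply: eq_bigr => j _; rewrite mxE exprMn.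
Qed.

Lemma le_of_le_add_small (R : realType) (a b k : R) : 0 <= k ->
  (forall t, 0 < t -> t <= 1 -> a <= b + t * k) -> a <= b.
Proof.
move=> k0 abk; apply/ler_addgt0Pr => e e0.
have ek0 : 0 < e + k by rewrite ltr_wpDr.
(* Given a slack [e], the step [e / (e + k)] costs at most [e]. Dividing by [e + k] instead of [k]
   keeps the step at most 1 and covers [k = 0]. *)
have t0 : 0 < e / (e + k) by rewrite divr_gt0.
have t1 : e / (e + k) <= 1 by rewrite ler_pdivrMr// mul1r lerDl.
apply: le_trans (abk _ t0 t1) _.
by rewrite lerD2l mulrAC ler_pdivrMr// ler_pM2l// lerDr ltW.
Qed.

Lemma convex_lower_feasible (R : realType) (n m l : nat)
  (Y : set 'rV[R]_m) (g : 'rV[R]_n -> 'rV[R]_m -> 'rV[R]_l) (x : 'rV[R]_n) :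
  convex_set Y ->
  (forall i : 'I_l, convex_function Y (fun y => g x y ord0 i)) ->
  convex_set (lower_feasible Y g x).
Proof.
move=> Ycvx gcvx w y t; rewrite !inE => -[Yw gw] [Yy gy].
split=> [|i]; first by apply/set_mem/Ycvx; rewrite inE.
(* Convexity bounds the constraint at the new point by a convex combination of two nonpositive
   values. *)
apply: le_trans (gcvx i t w y _ _) _; rewrite ?inE//.
by rewrite convRE -oppr_ge0 opprD addr_ge0// -mulrN mulr_ge0// ?oppr_ge0//
   subr_ge0 le1.
Qed.

Lemma moreau_minimizer_argmin (R : realType) (m : nat) (D : set 'rV[R]_m)
  (h : 'rV[R]_m -> R) (c : R) (y : 'rV[R]_m) :
  0 <= c -> convex_set D -> convex_function D h -> D y ->
  (forall w, D w -> h y <= h w + c * l2norm (w - y) ^+ 2) ->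
  forall w, D w -> h y <= h w.
Proof.
move=> c0 Dcvx hcvx Dy ymin w Dw.
apply: (@le_of_le_add_small _ _ _ (c * l2norm (w - y) ^+ 2)).
  by rewrite mulr_ge0// sqr_ge0.
move=> t t0 t1.
(* The weight [t] falls on [w], so [conv p w y] is the point reached from [y] by a step [t] towards
   [w]. *)
pose p : {i01 R} := Itv01 (ltW t0) t1.
have Dp : D (conv p (w : convex_lmodType 'rV[R]_m) y).
  by apply/set_mem/Dcvx; rewrite inE.
have hp := hcvx p w y (mem_set Dw) (mem_set Dy).
have pE : conv p (w : convex_lmodType 'rV[R]_m) y - y = t *: (w - y).
  by rewrite /conv/= scalerBl scale1r scalerBr -addrA [y - _]addrC addrK.
have := ymin _ Dp; rewrite pE l2normZ_sqr => /le_trans.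
move=> /(_ _ (lerD hp (lexx _))); rewrite convRE/= /unstable.onem => le1.
(* Cancelling [(1 - t) * h y] in [le1] leaves the goal multiplied by [t]: the penalty [t ^+ 2] loses
   one factor. *)
rewrite -(ler_pM2l t0); lra.
Qed.

Theorem theorem1 (R : realType) (n m l : nat)
  (X : set 'rV[R]_n) (Y : set 'rV[R]_m)
  (F f : 'rV[R]_n -> 'rV[R]_m -> R)
  (g : 'rV[R]_n -> 'rV[R]_m -> 'rV[R]_l)
  (S_neq0 : forall x, X x -> lower_argmin Y f g x !=set0)
  (gamma : R) (gamma_gt0 : 0 < gamma)
  (Y_closed : closed Y) (Y_convex : convex_set Y)
  (f_convex : forall x, X x -> convex_function Y (f x))
  (g_convex : forall x, X x -> forall i : 'I_l,
     convex_function Y (fun y => g x y ord0 i)) :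
  equivalent_problems (moreau_problem X Y F f g gamma)
                      (bilevel_problem X Y F f g).
Proof.
have c0 : 0 <= (2 * gamma)^-1 by rewrite invr_ge0 mulr_ge0// ltW.
(* The constraint becomes: [f x y] is a lower bound of the regularized values over the feasible
   [w]. *)
split=> //; apply/seteqP; split=> -[x y] /=; rewrite sube_le0.
- move=> [[[Xx Yy] xy] /ereal_infP ymin]; split=> //; split=> //.
  apply: (@moreau_minimizer_argmin _ _ _ _ _ _ c0) => //.
  + by apply: convex_lower_feasible => //; exact: g_convex.
  + move=> t w z /set_mem[Yw _] /set_mem[Yz _].
    by apply: f_convex => //; rewrite inE.
  + by move=> w xw; rewrite -lee_fin; apply: ymin; exists w.
(* Conversely, a minimizer of [f x] lies below every regularized value, since the proximal term is
   nonnegative. *)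
- move=> [[Xx Yy] [xy ymin]]; split=> //.
  apply/ereal_infP => _ [w xw <-]; rewrite lee_fin.
  by rewrite (le_trans (ymin _ xw))// lerDl mulr_ge0// sqr_ge0.
Qed.
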